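(* For every $n\in\mathbb{N}$ the set $\mathcal{B}_n\subset U(n)$ has nonempty interior in $U(n)$, i.e. it contains a nonempty open subset of $U(n)$.
   Context: A biunimodular vector for $A\in U(n)$ is a vector $v\in\mathbb{C}^n$ such that both $v$ and $Av$ have all entries of modulus one. $\mathcal{B}_n$ is the set of all $A\in U(n)$ that possess a biunimodular vector (equivalently, one with first entry equal to $1$). *)

(* Defs.v *)
From HB Require Import structures.
From mathcomp Require Import all_boot all_order all_algebra.
From mathcomp Require Import complex.
From mathcomp Require Import all_classical all_reals all_analysis.
Import numFieldNormedType.Exports.

Set Implicit Arguments.
Unset Strict Implicit.
Unset Printing Implicit Defensive.

Import Order.TTheory GRing.Theory Num.Theory.

Local Open Scope classical_set_scope.
Local Open Scope ring_scope.
Local Open Scope complex_scope.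

(* MathComp-Analysis provides the topology given by the modulus on the regular
   algebra R[i]^o only; it is transported to R[i], so that matrices over R[i]
   carry the entrywise topology. *)
HB.instance Definition _ (R : realType) := NormedModule.copy R[i] R[i]^o.

(* As a set of matrices, unitary_group R n coerces to the corresponding
   subtype, which MathComp-Analysis endows with the topology induced from
   'M[R[i]]_n. *)
Definition unitary_group (R : realType) (n : nat) : set 'M[R[i]]_n :=
  [set A | A \is unitarymx].
Arguments unitary_group : clear implicits.

Definition biunimodular (R : realType) (n : nat)
    (A : 'M[R[i]]_n) (v : 'cV[R[i]]_n) : Prop :=
  (forall i, `|v i 0| = 1) /\ (forall i, `|(A *m v) i 0| = 1).

Definition biunimodular_set (R : realType) (n : nat) :
    set (unitary_group R n) :=
  [set A | exists v, biunimodular (set_val A) v].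
Arguments biunimodular_set : clear implicits.

(* Main.v *)
(* Let P be the orthogonal projection onto the constant vectors and
   A0 = P + i(1 - P), a unitary matrix fixing the vector 1.  For A close to A0 we
   look for a biunimodular vector v = 1 + a + ib.  The equations |v_j|^2 = 1 and
   |(Av)_i|^2 = c, with c unspecified, are quadratic in (a, b); since
   Re(A0 v - 1)_i = mean(a) + mean(b) - b_i, a suitable choice of c turns them
   into a fixed point equation whose right-hand side is quadratic up to a small
   linear perturbation, hence a contraction near 0.  Banach's theorem gives a
   solution, and unitarity forces c = 1. *)

Require Import Defs.
From HB Require Import structures.
From mathcomp Require Import all_boot all_order all_algebra.
From mathcomp Require Import all_classical all_reals all_analysis.
From mathcomp Require Import complex ring lra.
Import numFieldNormedType.Exports.

Set Implicit Arguments.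
Unset Strict Implicit.

Import Order.TTheory GRing.Theory Num.Theory.

Local Open Scope classical_set_scope.
Local Open Scope ring_scope.

(** * Finite sums, matrix norms and fixed points *)

(** Banach's theorem is applied in ['M[R]_(2, n)], which must be known as a complete normed
    module. *)
HB.instance Definition _ (R : realType) (m n : nat) := Complete.on 'M[R]_(m, n).

Lemma ler_sum_const {R : realType} {n : nat} (F : 'I_n -> R) (c : R) :
  (forall j, `|F j| <= c) -> `|\sum_j F j| <= n%:R * c.
Proof.
move=> Fc; apply: (le_trans (ler_norm_sum _ _ _)).
have -> : n%:R * c = \sum_(j < n) c by rewrite sumr_const card_ord mulr_natl.
by apply: ler_sum => j _; exact: Fc.
Qed.

Lemma sum_delta {R : realType} {n : nat} (i : 'I_n) (u : 'I_n -> R) :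
  \sum_j (i == j)%:R * u j = u i.
Proof.
rewrite (bigD1 i)//= eqxx mul1r big1 ?addr0// => j /negPf ji.
by rewrite eq_sym ji mul0r.
Qed.

(** The index [i] witnesses that n is nonzero; for n = 0 the sum would be empty. *)
Lemma sum_inv {R : realType} {n : nat} (i : 'I_n) : \sum_(j < n) n%:R^-1 = 1 :> R.
Proof.
rewrite sumr_const card_ord -[LHS]mulr_natl divff// pnatr_eq0 -lt0n.
exact: leq_ltn_trans (ltn_ord i).
Qed.

(** If |x| <= r then |f x| <= |x| / 2 + r / 2 <= r, so [f] preserves the closed ball of radius [r]
    and Banach's theorem applies there. *)
Lemma half_lipschitz_fixed_point {R : realType} {X : completeNormedModType R}
    (f : X -> X) (r : R) :
  0 < r -> `|f 0| <= r / 2 ->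
  (forall x y, `|x| <= r -> `|y| <= r -> `|f x - f y| <= 2^-1 * `|x - y|) ->
  exists x, x = f x.
Proof.
move=> r0 f0 fL; pose U := [set x : X | `|x| <= r].
have fU : set_fun U U f.
  move=> x Ux; have := fL x 0 Ux; rewrite normr0 subr0 => /(_ (ltW r0)) fx0.
  have := ler_normD (f x - f 0) (f 0); rewrite subrK /U/= => fx.
  by rewrite /U/= in Ux; lra.
have [|||x _ xE] := @banach_fixed_point R X U (mkfun fU); last by exists x.
- exists (2^-1)%:nng; split=> /=; first by lra.
  by move=> [x y] [Ux Uy] /=; exact: fL.
- have -> : U = closed_ball_ Num.norm 0 r.
    by apply/seteqP; split => x; rewrite /U/closed_ball_/= sub0r normrN.
  exact: closed_closed_ball_.
- by exists 0; rewrite /U/= normr0 ltW.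
Qed.

Lemma mx_coord_le {R : realType} {m n : nat} (x : 'M[R]_(m, n)) i j :
  `|x i j| <= `|x|.
Proof.
rewrite [leRHS]mx_normrE.
by apply: (le_bigmax _ (fun k : 'I_m * 'I_n => `|x k.1 k.2|) (i, j)).
Qed.

Lemma mx_norm_le {R : realType} {m n : nat} (x : 'M[R]_(m, n)) (c : R) :
  0 <= c -> (forall i j, `|x i j| <= c) -> `|x| <= c.
Proof.
move=> c0 xc; rewrite [leLHS]mx_normrE; apply/bigmax_leP; split=> //.
Qed.

(** * Real and imaginary parts, elementary estimates *)

Lemma ler_norm_Re {R : rcfType} (z : R[i]) (c : R) :
  `|z| <= c%:C%C -> `|complex.Re z| <= c.
Proof. by move=> zc; rewrite -lecR (le_trans (normc_ge_Re z)). Qed.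

Lemma ler_norm_Im {R : rcfType} (z : R[i]) (c : R) :
  `|z| <= c%:C%C -> `|complex.Im z| <= c.
Proof.
move=> zc; rewrite -normrN -ReiNIm; apply: ler_norm_Re.
by rewrite normrM (normc_def 'i%C) /= expr0n/= expr1n add0r sqrtr1 mulr1.
Qed.

Lemma Re_sum {R : rcfType} {n : nat} (F : 'I_n -> R[i]) :
  complex.Re (\sum_j F j) = \sum_j complex.Re (F j).
Proof. by apply: (big_morph _ (fun x y => _) _) => // -[a b] [c d]. Qed.

Lemma Im_sum {R : rcfType} {n : nat} (F : 'I_n -> R[i]) :
  complex.Im (\sum_j F j) = \sum_j complex.Im (F j).
Proof. by apply: (big_morph _ (fun x y => _) _) => // -[a b] [c d]. Qed.

Lemma ler_normB_le {R : realType} (a b c d : R) :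
  `|a| <= c -> `|b| <= d -> `|a - b| <= c + d.
Proof. by move=> ? ?; rewrite (le_trans (ler_normB _ _))// lerD. Qed.

Lemma ler_normD_le {R : realType} (a b c d : R) :
  `|a| <= c -> `|b| <= d -> `|a + b| <= c + d.
Proof. by move=> ? ?; rewrite (le_trans (ler_normD _ _))// lerD. Qed.

Lemma ler_normM_le {R : realType} (a b c d : R) :
  `|a| <= c -> `|b| <= d -> `|a * b| <= c * d.
Proof. by move=> ? ?; rewrite normrM ler_pM. Qed.

(** Factoring leaves the mean of [a] and [b], bounded by [c]: this makes quadratic terms contracting
    near 0. *)
Lemma ler_norm_half_sqrB {R : realType} (a b c d : R) :
  `|a - b| <= d -> `|a| <= c -> `|b| <= c ->
  `|(a ^+ 2 - b ^+ 2) / 2| <= d * c.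
Proof.
move=> ab ac bc; rewrite (_ : _ / 2 = (a - b) * ((a + b) / 2)); last by field.
apply: ler_normM_le => //; move: ac bc; rewrite !ler_norml => /andP[? ?] /andP[? ?].
by apply/andP; split; lra.
Qed.

(** * The real fixed point problem *)

(* For [A = B + i C] and [v = 1 + x_0 + i x_1], these are the real and imaginary
   parts of [A v - 1]. *)
Definition re_part {R : realType} {n : nat} (B C : 'M[R]_n) (x : 'M[R]_(2, n))
    (i : 'I_n) : R :=
  \sum_j (B i j * (1 + x 0 j) - C i j * x 1 j) - 1.

Definition im_part {R : realType} {n : nat} (B C : 'M[R]_n) (x : 'M[R]_(2, n))
    (i : 'I_n) : R :=
  \sum_j (C i j * (1 + x 0 j) + B i j * x 1 j).

(* A fixed point satisfies [|v_j| = 1] for all [j], and [|(A v)_i|] does not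
   depend on [i]. *)
Definition phase_step {R : realType} {n : nat} (B C : 'M[R]_n)
    (x : 'M[R]_(2, n)) : 'M[R]_(2, n) :=
  \matrix_(k, j) if k == 0 then - (x 0 j ^+ 2 + x 1 j ^+ 2) / 2
    else (re_part B C x j ^+ 2 + im_part B C x j ^+ 2) / 2 + re_part B C x j
         + x 1 j - (\sum_l (x 0 l + x 1 l)) / n%:R.

(** The first factor is the radius of the ball on which [phase_step] contracts; dividing it by 4 (n
    + 1) keeps a row of entrywise errors below a quarter of that radius. Taking n + 1 instead of n
    avoids a zero denominator when n = 0. *)
Definition tolerance (R : realType) (n : nat) : R :=
  (100 * n.+1%:R ^+ 2)^-1 / (4 * n.+1%:R).

(* [phase_step] is a contraction of the ball of radius [r] whenever [B] and [C]
   are within [e] of [J / n] and [1 - J / n], [J] being the all-ones matrix. *)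
Section PhaseStep.
Variables (R : realType) (n : nat) (B C : 'M[R]_n).
Let N : R := n.+1%:R.
Let r : R := (100 * N ^+ 2)^-1.
Let e : R := tolerance R n.
Hypothesis B_near : forall i j, `|B i j - n%:R^-1| <= e.
Hypothesis C_near : forall i j, `|C i j - ((i == j)%:R - n%:R^-1)| <= e.

Let N_ge1 : 1 <= N. Proof. by rewrite ler1n. Qed.
Let N_neq0 : N != 0. Proof. by rewrite pnatr_eq0. Qed.
Let nN : n%:R <= N. Proof. by rewrite ler_nat. Qed.
Let rN : r * N ^+ 2 = 100^-1.
Proof. by rewrite /r; field. Qed.
Let eN : e * N = r / 4.
Proof. by rewrite /e /tolerance -/N -/r; field. Qed.
Let r_gt0 : 0 < r.
Proof. by rewrite invr_gt0 mulr_gt0 ?exprn_gt0// ltr0n. Qed.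
Let e_gt0 : 0 < e.
Proof. by rewrite divr_gt0// mulr_gt0// ltr0n. Qed.
Let r_le : r * N <= 100^-1.
Proof. by rewrite -rN expr2 ler_pM2l// ler_peMr// (le_trans _ N_ge1). Qed.
Let r_le_rN : r <= r * N.
Proof. by rewrite ler_peMr// ltW. Qed.
Let e_le : e <= 400^-1.
Proof.
have : e <= e * N by rewrite ler_peMr// ltW.
by rewrite eN; have := r_le; have := r_le_rN; lra.
Qed.

Let inv_nat_bound (i : 'I_n) : 0 <= (n%:R^-1 : R) <= 1.
Proof.
rewrite invr_ge0 ler0n invf_le1 ?ler1n ?ltr0n//=; exact: leq_ltn_trans (ltn_ord i).
Qed.

Let B_bound i j : `|B i j| <= 2.
Proof.
have := B_near i j; have /andP[? ?] := inv_nat_bound i; have := e_le.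
by rewrite !ler_norml => ? /andP[? ?]; apply/andP; split; lra.
Qed.

Let C_bound i j : `|C i j| <= 2.
Proof.
have := C_near i j; have /andP[? ?] := inv_nat_bound i; have := e_le.
rewrite !ler_norml => ? /andP[]; case: (i == j) => /= ? ?;
  by apply/andP; split; lra.
Qed.

Let ler_sum_N (F : 'I_n -> R) (c : R) :
  0 <= c -> (forall j, `|F j| <= c) -> `|\sum_j F j| <= N * c.
Proof.
move=> c0 Fc; apply: (le_trans (@ler_sum_const _ _ _ _ Fc)).
exact: ler_wpM2r.
Qed.

(** The sum has at most [N] terms, each with two coefficients bounded by 2. *)
Let re_lip x y i : `|re_part B C x i - re_part B C y i| <= 4 * N * `|x - y|.
Proof.
have -> : re_part B C x i - re_part B C y i
    = \sum_j (B i j * (x - y) 0 j - C i j * (x - y) 1 j).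
  by rewrite /re_part opprB addrA subrK -sumrB;
    apply: eq_bigr => j _; rewrite !mxE; ring.
rewrite (_ : 4 * N * _ = N * (2 * `|x - y| + 2 * `|x - y|)); last by ring.
apply: ler_sum_N => [|j]; first by rewrite addr_ge0 ?mulr_ge0.
by apply: ler_normB_le; apply: ler_normM_le; rewrite ?mx_coord_le.
Qed.

Let im_lip x y i : `|im_part B C x i - im_part B C y i| <= 4 * N * `|x - y|.
Proof.
have -> : im_part B C x i - im_part B C y i
    = \sum_j (C i j * (x - y) 0 j + B i j * (x - y) 1 j).
  by rewrite /im_part -sumrB; apply: eq_bigr => j _; rewrite !mxE; ring.
rewrite (_ : 4 * N * _ = N * (2 * `|x - y| + 2 * `|x - y|)); last by ring.
apply: ler_sum_N => [|j]; first by rewrite addr_ge0 ?mulr_ge0.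
by apply: ler_normD_le; apply: ler_normM_le; rewrite ?mx_coord_le.
Qed.

(** The rows of J / n sum to 1 and those of 1 - J / n to 0, so at 0 only the errors remain in
    [re_part] and, likewise, in [im_part]. *)
Let re0 i : `|re_part B C 0 i| <= N * e.
Proof.
have -> : re_part B C 0 i = \sum_j (B i j - n%:R^-1).
  rewrite sumrB (sum_inv i); congr (_ - 1).
  by apply: eq_bigr => j _; rewrite !mxE addr0 mulr1 mulr0 subr0.
by apply: ler_sum_N; first exact: ltW.
Qed.

Let im0 i : `|im_part B C 0 i| <= N * e.
Proof.
have -> : im_part B C 0 i = \sum_j (C i j - ((i == j)%:R - n%:R^-1)).
  rewrite sumrB sumrB (sum_inv i) -[X in _ - (X - _)](eq_bigr _ (fun j _ => mulr1 _)).
  rewrite (sum_delta i (fun=> 1)) subrr subr0.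
  by apply: eq_bigr => j _; rewrite !mxE addr0 mulr1 mulr0 addr0.
by apply: ler_sum_N; first exact: ltW.
Qed.

Let re_bound x i : `|x| <= r -> `|re_part B C x i| <= 5 * N * r.
Proof.
move=> xr; have := re_lip x 0 i; have := re0 i; rewrite subr0 => h0 h1.
have := ler_normD_le h1 h0; rewrite subrK => /le_trans; apply.
(* The two bounds add up to 4 N r + r / 4. *)
by have := eN; have := N_ge1; have := r_gt0; nra.
Qed.

Let im_bound x i : `|x| <= r -> `|im_part B C x i| <= 5 * N * r.
Proof.
move=> xr; have := im_lip x 0 i; have := im0 i; rewrite subr0 => h0 h1.
have := ler_normD_le h1 h0; rewrite subrK => /le_trans; apply.
by have := eN; have := N_ge1; have := r_gt0; nra.
Qed.

(* This linear part of [phase_step] vanishes for [B = J / n], [C = 1 - J / n]. *)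
Let linear_part_lip x y i :
  `|(re_part B C x i + x 1 i - (\sum_l (x 0 l + x 1 l)) / n%:R)
    - (re_part B C y i + y 1 i - (\sum_l (y 0 l + y 1 l)) / n%:R)|
  <= N * (e * `|x - y| + e * `|x - y|).
Proof.
pose D := \sum_j ((B i j - n%:R^-1) * (x - y) 0 j
                  - (C i j - ((i == j)%:R - n%:R^-1)) * (x - y) 1 j).
have sumE (z : 'M[R]_(2, n)) :
    re_part B C z i + z 1 i - (\sum_l (z 0 l + z 1 l)) / n%:R =
    \sum_j (B i j * (1 + z 0 j) - C i j * z 1 j + (i == j)%:R * z 1 j
            - (z 0 j + z 1 j) / n%:R) - 1.
  rewrite sumrB [X in _ = X - _ - 1]big_split/= (sum_delta i (z 1)) -mulr_suml.
  by rewrite /re_part; ring.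
rewrite !sumE opprB addrA subrK -sumrB (_ : \sum_j _ = D); last first.
  by apply: eq_bigr => j _; rewrite !mxE; ring.
have e0 := ltW e_gt0; apply: ler_sum_N => [|j]; first by apply: addr_ge0; apply: mulr_ge0.
by apply: ler_normB_le; apply: ler_normM_le; rewrite ?mx_coord_le.
Qed.

Lemma phase_step_lip x y : `|x| <= r -> `|y| <= r ->
  `|phase_step B C x - phase_step B C y| <= 2^-1 * `|x - y|.
Proof.
move=> xr yr; apply: mx_norm_le => [|k i]; first by rewrite mulr_ge0.
have d0 := normr_ge0 (x - y); set d := `|x - y| in d0 *.
have cd (z : 'M[R]_(2, n)) k' : `|z| <= r -> `|z k' i| <= r.
  exact: le_trans (mx_coord_le _ _ _).
have xyd k' : `|x k' i - y k' i| <= d.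
  by have := mx_coord_le (x - y) k' i; rewrite !mxE.
rewrite !mxE; case: ifP => _.
  (* Row 0 is purely quadratic, with Lipschitz constant 2 r. *)
  have h0 := ler_norm_half_sqrB (xyd 0) (cd x 0 xr) (cd y 0 yr).
  have h1 := ler_norm_half_sqrB (xyd 1) (cd x 1 xr) (cd y 1 yr).
  rewrite -normrN (_ : - _ = (x 0 i ^+ 2 - y 0 i ^+ 2) / 2 +
    (x 1 i ^+ 2 - y 1 i ^+ 2) / 2); last by field.
  rewrite (le_trans (ler_normD_le h0 h1))//.
  by have := r_le; have := N_ge1; have := r_gt0; nra.
have h0 := ler_norm_half_sqrB (re_lip x y i) (re_bound i xr) (re_bound i yr).
have h1 := ler_norm_half_sqrB (im_lip x y i) (im_bound i xr) (im_bound i yr).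
have h2 := ler_normD_le (ler_normD_le h0 h1) (linear_part_lip x y i).
have sumE (p p' q q' u u' m m' : R) :
    (p ^+ 2 + q ^+ 2) / 2 + p + u - m - ((p' ^+ 2 + q' ^+ 2) / 2 + p' + u' - m') =
    (p ^+ 2 - p' ^+ 2) / 2 + (q ^+ 2 - q' ^+ 2) / 2 + (p + u - m - (p' + u' - m')).
  by field.
rewrite sumE; apply: (le_trans h2); rewrite -/d.
(* The factor of [d] equals 2/5 + r / 2, which is below 1/2; the 100 in [r] is chosen for this. *)
have -> : 4 * N * d * (5 * N * r) + 4 * N * d * (5 * N * r)
            + N * (e * d + e * d) = (40 * (r * N ^+ 2) + 2 * (e * N)) * d.
  by clear; move: N r e d => *; ring.
rewrite rN eN; apply: ler_wpM2r => //.
by have := r_le; have := N_ge1; have := r_gt0; nra.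
Qed.

Lemma phase_step0 : `|phase_step B C 0| <= r / 2.
Proof.
apply: mx_norm_le => [|k i]; first by rewrite divr_ge0 ?ltW.
rewrite !mxE; case: ifP => _.
  by rewrite expr0n/= addr0 oppr0 mul0r normr0 divr_ge0 ?ltW.
rewrite (big1 _ _ (fun l => _)); last by move=> l _; rewrite !mxE addr0.
rewrite mul0r subr0 addr0.
move: (re0 i) (im0 i); rewrite [N * e]mulrC eN.
set p := re_part _ _ _ _; set q := im_part _ _ _ _.
have := r_le; have := N_ge1; have := r_gt0 => ? ? ?.
rewrite !ler_norml => /andP[? ?] /andP[? ?].
(* Since r <= 1, (r / 4)^2 <= r / 16; then r / 16 + r / 4 <= r / 2. *)
have ? : p ^+ 2 <= r / 16 by nra.
have ? : q ^+ 2 <= r / 16 by nra.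
by apply/andP; split; nra.
Qed.

Lemma phase_solution : exists x : 'M[R]_(2, n),
  (forall j, (1 + x 0 j) ^+ 2 + x 1 j ^+ 2 = 1) /\
  (exists c, forall i, (re_part B C x i + 1) ^+ 2 + im_part B C x i ^+ 2 = c).
Proof.
have [x xE] := half_lipschitz_fixed_point r_gt0 phase_step0 phase_step_lip.
exists x; split=> [j|].
  by have /matrixP/(_ 0 j) := xE; rewrite !mxE/= => h; lra.
(* In row 1 of the fixed point equation [x 1 i] cancels, which leaves (|(A v)_i|^2 - 1) / 2 equal to
   the mean, independent of [i]. *)
exists (1 + 2 * ((\sum_l (x 0 l + x 1 l)) / n%:R)) => i.
by have /matrixP/(_ 1 i) := xE; rewrite !mxE/= => h; lra.
Qed.

End PhaseStep.

(** * Unitary matrices and biunimodular vectors *)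

Lemma Re_mul {R : rcfType} (x y : R[i]) :
  complex.Re (x * y) = complex.Re x * complex.Re y - complex.Im x * complex.Im y.
Proof. by case: x; case: y. Qed.

Lemma Im_mul {R : rcfType} (x y : R[i]) :
  complex.Im (x * y) = complex.Re x * complex.Im y + complex.Im x * complex.Re y.
Proof. by case: x; case: y. Qed.

Lemma normc_eq1 {R : rcfType} (z : R[i]) :
  complex.Re z ^+ 2 + complex.Im z ^+ 2 = 1 -> `|z| = 1.
Proof. by move=> z1; rewrite normc_def z1 sqrtr1. Qed.

(* [P + i (1 - P)], where [P] is the projection onto constant vectors. *)
Definition base_mx (R : realType) (n : nat) : 'M[R[i]]_n :=
  \matrix_(i, j) (n%:R^-1 +i* ((i == j)%:R - n%:R^-1))%C.

(** The matrix acts as 1 and i on two orthogonal subspaces. The proof checks A A* = 1 entrywise, on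
    real and imaginary parts. *)
Lemma base_mx_unitary (R : realType) (n : nat) : base_mx R n \is unitarymx.
Proof.
apply/unitarymxP/matrixP => i j; rewrite !mxE.
have sum_sqr : \sum_(k < n) n%:R^-1 * n%:R^-1 = n%:R^-1 :> R.
  by rewrite -mulr_suml (sum_inv i) mul1r.
pose d (a b : 'I_n) : R := (a == b)%:R; pose m : R := n%:R^-1.
transitivity (\sum_k ((m * m + (d i k - m) * (d j k - m))
                       +i* (m * (d i k - d j k)))%C).
  apply: eq_bigr => k _; rewrite !mxE; apply/eqP.
  rewrite eq_complex /= /d /m; apply/andP; split; apply/eqP; ring.
have dE (a b : 'I_n) : ((a == b)%:R : R[i]) = (d a b)%:C%C by rewrite /d; case: eqP.
rewrite dE; apply/eqP; rewrite eq_complex Re_sum Im_sum; apply/andP; split; apply/eqP.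
  (* The Kronecker symbols contribute -2 m, cancelled by the two sums of m * m. *)
  transitivity (\sum_k (d i k * (d j k - m) - d j k * m + (m * m + m * m))).
    by apply: eq_bigr => k _ /=; ring.
  by rewrite big_split sumrB big_split /= !sum_delta sum_sqr /d eq_sym /m; ring.
transitivity (\sum_k (d i k * m - d j k * m)).
  by apply: eq_bigr => k _ /=; ring.
by rewrite sumrB !sum_delta subrr.
Qed.

(** Both sides have the form w* w, and A* A = 1. *)
Lemma unitary_sum_sqr_norm (R : realType) (n : nat) (A : 'M[R[i]]_n)
    (v : 'cV[R[i]]_n) : A \is unitarymx ->
  \sum_i `|(A *m v) i 0| ^+ 2 = \sum_i `|v i 0| ^+ 2.
Proof.
move=> uA.
have sqE (w : 'cV[R[i]]_n) : \sum_i `|w i 0| ^+ 2 = ((w ^t*)%sesqui *m w) 0 0.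
  by rewrite mxE; apply: eq_bigr => i _; rewrite !mxE mulrC normCK.
rewrite !sqE trmx_mul map_mxM -mulmxA (mulmxA _ A).
by rewrite -(invmx_unitary uA) mulVmx ?unitarymx_unit// mul1mx.
Qed.

Lemma biunimodular_near_base_mx {R : realType} {n : nat} (A : 'M[R[i]]_n) :
  A \is unitarymx ->
  (forall i j, `|A i j - base_mx R n i j|
     <= (tolerance R n)%:C%C) ->
  exists v, biunimodular A v.
Proof.
move=> uA Anear.
pose B := \matrix_(i, j) complex.Re (A i j); pose C := \matrix_(i, j) complex.Im (A i j).
have [|i j|x [x1 [c xc]]] := @phase_solution R n B C.
- move=> i j; have := ler_norm_Re (Anear i j).
  by rewrite !mxE; case: (A i j).
- by have := ler_norm_Im (Anear i j); rewrite !mxE; case: (A i j).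
pose v := \col_j ((1 + x 0 j) +i* x 1 j)%C; exists v.
have v1 i : `|v i 0| = 1 by apply: normc_eq1; rewrite mxE /=.
split=> // i.
have Re_Av k : complex.Re ((A *m v) k 0) = re_part B C x k + 1.
  rewrite mxE Re_sum /re_part subrK; apply: eq_bigr => j _.
  by rewrite Re_mul !mxE.
have Im_Av k : complex.Im ((A *m v) k 0) = im_part B C x k.
  rewrite mxE Im_sum /im_part; apply: eq_bigr => j _.
  by rewrite Im_mul !mxE addrC.
have sqr_Av k : `|(A *m v) k 0| ^+ 2 = c%:C%C.
  by rewrite -add_Re2_Im2 Re_Av Im_Av xc.
apply: normc_eq1; rewrite Re_Av Im_Av xc.
(* It remains to show c = 1. Summing over the coordinates gives c n = n, and the coordinate [i]
   ensures that n is nonzero. *)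
have n0 : (n%:R : R[i]) != 0.
  by rewrite pnatr_eq0 -lt0n (leq_ltn_trans _ (ltn_ord i)).
have v_sqr k : `|v k 0| ^+ 2 = 1 by rewrite v1 expr1n.
have := unitary_sum_sqr_norm v uA.
rewrite (eq_bigr _ (fun k _ => sqr_Av k)) [RHS](eq_bigr _ (fun k _ => v_sqr k)).
by rewrite !sumr_const card_ord -mulr_natr -[RHS]mulr_natr => /(mulIf n0) [].
Qed.

(** * Passage to the topology of the unitary group *)

(** The subtype carries the initial topology of [set_val], so the preimage of [U] is a neighbourhood
    of [x]. *)
Lemma interior_set_type {T : topologicalType} {A : set T} (S : set A) (x : A)
    (U : set T) :
  nbhs (set_val x) U -> (forall y : A, U (set_val y) -> S y) -> S° x.
Proof.
move=> xU US; have xU' : nbhs x (@set_val _ A @^-1` U).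
  exact: (@initial_continuous _ _ (@set_val _ A) x U xU).
by apply: (filterS _ xU') => y; exact: US.
Qed.

Lemma nbhs_mx_coord {K : numFieldType} {V : normedModType K} {m n : nat}
    (M : 'M[V]_(m, n)) (e : K) :
  0 < e -> nbhs M [set M' | forall i j, `|M i j - M' i j| < e].
Proof.
move=> e0; apply: filterS (nbhsx_ballx M _ e0) => M' [_ MM'] i j.
by have := MM' i j; rewrite -ball_normE.
Qed.

Theorem theorem9p9 (R : realType) (n : nat) :
  (biunimodular_set R n)° !=set0.
Proof.
have uA0 : base_mx R n \in unitary_group R n.
  by rewrite inE; exact: base_mx_unitary.
have e0 : (0 : R[i]) < (tolerance R n)%:C%C.
  by rewrite ltcR divr_gt0 ?invr_gt0 ?mulr_gt0 ?exprn_gt0 ?ltr0n.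
exists (exist _ (base_mx R n) uA0).
apply: (@interior_set_type _ _ (biunimodular_set R n) _
  [set M | forall i j, `|base_mx R n i j - M i j| < (tolerance R n)%:C%C]).
  exact: nbhs_mx_coord.
move=> A A_near; apply: biunimodular_near_base_mx => [|i j].
  by have := valP A; rewrite inE.
by have := A_near i j; rewrite -normrN opprB => /ltW.
Qed.
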